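(* Assume that the system $[A,C;B,D]$ is $L^2$-stabilizable and that $Q\in\mathbb{S}^n_+$, $R\in\mathbb{S}^m_+$. Then Problem (O), i.e. the minimization of $$F(x,u)=\langle Qx,x\rangle+\langle Ru,u\rangle+2\langle q,x\rangle+\langle P(Cx+Du+\sigma),Cx+Du+\sigma\rangle$$ over $\mathscr V=\{(x,u)\in\mathbb{R}^n\times\mathbb{R}^m: Ax+Bu+b=0\}$, admits a unique solution $(x^*,u^* )\in\mathscr V$. Moreover this solution, together with a Lagrange multiplier, is characterized by a linear system: a pair $(x^*,u^* )\in\mathscr V$ is the solution of Problem (O) if and only if there exists $\lambda^*\in\mathbb{R}^n$ such that $$\begin{cases}Qx^*+A^\top\lambda^*+C^\top P(Cx^*+Du^*+\sigma)+q=0,\\ Ru^*+B^\top\lambda^*+D^\top P(Cx^*+Du^*+\sigma)=0.\end{cases}$$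
   Context: Notation. $\mathbb{S}^n$ is the space of symmetric real $n\times n$ matrices and $\mathbb{S}^n_+$ the subset of positive definite ones. The data are constant: $A,C\in\mathbb{R}^{n\times n}$, $B,D\in\mathbb{R}^{n\times m}$, $Q\in\mathbb{S}^n$, $R\in\mathbb{S}^m$, $b,\sigma,q\in\mathbb{R}^n$. $W$ is a standard one-dimensional Brownian motion. Stabilizability. For $\mathcal A,\mathcal C\in\mathbb{R}^{n\times n}$, the system $[\mathcal A,\mathcal C]$, i.e. $dX=\mathcal A X\,dt+\mathcal C X\,dW$, $X(0)=x$, is $L^2$-stable if $\mathbb{E}\int_0^\infty|X(t;x)|^2dt<\infty$ for all $x\in\mathbb{R}^n$. The controlled system $[A,C;B,D]$, i.e. $dX=(AX+Bu)dt+(CX+Du)dW$, is $L^2$-stabilizable if there is $\Theta\in\mathbb{R}^{m\times n}$ (a stabilizer) such that $[A+B\Theta,C+D\Theta]$ is $L^2$-stable. Algebraic Riccati equation (ARE). Under the stated assumptions, $P\in\mathbb{S}^n_+$ denotes the unique positive definite solution of $$PA+A^\top P+C^\top PC+Q-(PB+C^\top PD)(R+D^\top PD)^{-1}(B^\top P+D^\top PC)=0$$ (it is known to exist, to be unique, and to be stabilizing, i.e. $-(R+D^\top PD)^{-1}(B^\top P+D^\top PC)$ is a stabilizer of $[A,C;B,D]$). *)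

(* Defs.v *)
From HB Require Import structures.
From mathcomp Require Import all_boot all_order all_algebra.
From mathcomp Require Import all_classical all_reals all_analysis.
Set Implicit Arguments.
Unset Strict Implicit.
Unset Printing Implicit Defensive.
Import Order.TTheory GRing.Theory Num.Theory.
Import numFieldNormedType.Exports.
Local Open Scope classical_set_scope.
Local Open Scope ring_scope.

(* Euclidean inner product; the library norm on matrices is the sup norm. *)
Definition vdot (K : realType) (n : nat) (x y : 'cV[K]_n) : K :=
  \sum_(i < n) x i 0 * y i 0.

Definition symmetric_mx (K : realType) (n : nat) (M : 'M[K]_n) : Prop :=
  M^T = M.

Definition posdef_mx (K : realType) (n : nat) (M : 'M[K]_n) : Prop :=
  symmetric_mx M /\ forall x : 'cV[K]_n, x != 0 -> 0 < vdot (M *m x) x.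

(* Processes are indexed by all of K; only times t >= 0 are ever used. *)

Definition natural_filtration (K : realType) (d : measure_display)
    (T : measurableType d) (W : K -> T -> K) (t : K) : set (set T) :=
  <<s [set A | exists s B, [/\ 0 <= s, s <= t, measurable B
                             & A = W s @^-1` B]] >>.

Definition augmented_filtration (K : realType) (d : measure_display)
    (T : measurableType d) (Pr : probability T K) (W : K -> T -> K) (t : K) :
    set (set T) :=
  [set A | measurable A /\ exists2 B, natural_filtration W t B
    & Pr.-negligible ((A `\` B) `|` (B `\` A))].

Definition measurable_wrt (K : realType) (T : Type) (G : set (set T))
    (Y : T -> K) : Prop :=
  forall B : set K, measurable B -> G (Y @^-1` B).

(* The second argument of normal_prob is the standard deviation. *)
Definition brownian_motion (K : realType) (d : measure_display)
    (T : measurableType d) (Pr : probability T K) (W : K -> {RV Pr >-> K}) :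
    Prop :=
  let increment s t := fun w => W t w - W s w in
  [/\ {ae Pr, forall w, W 0 w = 0},
      {ae Pr, forall w, {within `[0, +oo[, continuous (fun t => W t w)}},
      forall s t : K, 0 <= s -> s < t -> forall B : set K, measurable B ->
        Pr (increment s t @^-1` B)
        = normal_prob 0 (Num.sqrt (t - s)) B
    & forall s t : K, 0 <= s -> s < t ->
      forall (A : set T) (B : set K),
        natural_filtration (fun r => W r : T -> K) s A -> measurable B ->
        Pr (A `&` increment s t @^-1` B)
        = (Pr A * Pr (increment s t @^-1` B))%E].

(* The step process \sum_(i < si_size) si_coef i on ]si_grid i, si_grid i.+1]. *)
Record simple_integrand (K : realType) (T : Type) := SimpleIntegrand {
  si_size : nat;
  si_grid : nat -> K;
  si_coef : nat -> T -> K }.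

Definition simple_admissible (K : realType) (d : measure_display)
    (T : measurableType d) (Pr : probability T K) (W : K -> T -> K) (t : K)
    (H : simple_integrand K T) : Prop :=
  [/\ 0 <= si_grid H 0,
      si_grid H (si_size H) <= t,
      forall i : nat, (i < si_size H)%N -> si_grid H i <= si_grid H i.+1,
      forall i : nat, (i < si_size H)%N ->
        measurable_wrt (augmented_filtration Pr W (si_grid H i)) (si_coef H i)
    & forall i : nat, (i < si_size H)%N ->
        exists M : K, forall w, `|si_coef H i w| <= M].

Definition simple_eval (K : realType) (T : Type) (H : simple_integrand K T)
    (s : K) (w : T) : K :=
  \sum_(i < si_size H) si_coef H i w * \1_(`]si_grid H i, si_grid H i.+1]) s.

Definition simple_ito (K : realType) (T : Type) (W : K -> T -> K)
    (H : simple_integrand K T) (w : T) : K :=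
  \sum_(i < si_size H)
    si_coef H i w * (W (si_grid H i.+1) w - W (si_grid H i) w).

(* I is (a version of) the Ito integral of H against W over [0, t]: the limit
   in L^2(Pr) of the integrals of adapted simple processes converging to H in
   L^2([0, t] x T). *)
Definition is_ito_integral (K : realType) (d : measure_display)
    (T : measurableType d) (Pr : probability T K) (W : K -> T -> K) (t : K)
    (H : K -> T -> K) (I : {RV Pr >-> K}) : Prop :=
  exists Hk : nat -> simple_integrand K T,
    [/\ forall k, simple_admissible Pr W t (Hk k),
        (fun k => \int[Pr]_w \int[lebesgue_measure]_(s in `[0%R, t])
           ((H s w - simple_eval (Hk k) s w) ^+ 2)%:E)%E @ \oo --> 0%E
      & (fun k => \int[Pr]_w ((I w - simple_ito W (Hk k) w) ^+ 2)%:E)%E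
          @ \oo --> 0%E].

(* X is a strong solution of dX = A X dt + C X dW, X(0) = x.
   Continuity of every path (not only almost every one) makes X jointly
   measurable, and is obtained by modifying X on a null event. *)
Definition is_sde_solution (K : realType) (d : measure_display)
    (T : measurableType d) (Pr : probability T K) (W : K -> {RV Pr >-> K})
    (n : nat) (A C : 'M[K]_n) (x : 'cV[K]_n) (X : K -> T -> 'cV[K]_n) : Prop :=
  [/\ forall t (i : 'I_n), 0 <= t ->
        measurable_wrt (augmented_filtration Pr (fun r => W r : T -> K) t)
          (fun w => X t w i 0),
      forall w (i : 'I_n), {within `[0, +oo[, continuous (fun t => X t w i 0)}
    & forall t (i : 'I_n), 0 <= t ->
        exists2 I : {RV Pr >-> K},
          is_ito_integral (fun r => W r : T -> K) t
            (fun s w => (C *m X s w) i 0) I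
          & {ae Pr, forall w, X t w i 0 =
              x i 0 + \int[lebesgue_measure]_(s in `[0, t]) (A *m X s w) i 0
              + I w}].

Definition L2_stable (K : realType) (d : measure_display)
    (T : measurableType d) (Pr : probability T K) (W : K -> {RV Pr >-> K})
    (n : nat) (A C : 'M[K]_n) : Prop :=
  forall x : 'cV[K]_n, exists2 X : K -> T -> 'cV[K]_n,
    is_sde_solution W A C x X
    & (\int[Pr]_w \int[lebesgue_measure]_(t in `[0%R, +oo[)
         (vdot (X t w) (X t w))%:E < +oo)%E.

Definition L2_stabilizable (K : realType) (d : measure_display)
    (T : measurableType d) (Pr : probability T K) (W : K -> {RV Pr >-> K})
    (n m : nat) (A C : 'M[K]_n) (B D : 'M[K]_(n, m)) : Prop :=
  exists Theta : 'M[K]_(m, n),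
    L2_stable W (A + B *m Theta) (C + D *m Theta).

Definition riccati_equation (K : realType) (n m : nat) (A C : 'M[K]_n)
    (B D : 'M[K]_(n, m)) (Q : 'M[K]_n) (R : 'M[K]_m) (P : 'M[K]_n) : Prop :=
  P *m A + A^T *m P + C^T *m P *m C + Q
  - (P *m B + C^T *m P *m D) *m invmx (R + D^T *m P *m D)
    *m (B^T *m P + D^T *m P *m C) = 0.

Definition objective (K : realType) (n m : nat) (C : 'M[K]_n)
    (D : 'M[K]_(n, m)) (Q : 'M[K]_n) (R : 'M[K]_m) (sigma q : 'cV[K]_n)
    (P : 'M[K]_n) (x : 'cV[K]_n) (u : 'cV[K]_m) : K :=
  let z := C *m x + D *m u + sigma in
  vdot (Q *m x) x + vdot (R *m u) u + 2 * vdot q x + vdot (P *m z) z.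

Definition feasible (K : realType) (n m : nat) (A : 'M[K]_n)
    (B : 'M[K]_(n, m)) (b x : 'cV[K]_n) (u : 'cV[K]_m) : Prop :=
  A *m x + B *m u + b = 0.

Definition solves_problem_O (K : realType) (n m : nat) (A C : 'M[K]_n)
    (B D : 'M[K]_(n, m)) (Q : 'M[K]_n) (R : 'M[K]_m) (b sigma q : 'cV[K]_n)
    (P : 'M[K]_n) (x : 'cV[K]_n) (u : 'cV[K]_m) : Prop :=
  feasible A B b x u /\
  forall y v, feasible A B b y v ->
    objective C D Q R sigma q P x u <= objective C D Q R sigma q P y v.

(* Main.v *)
Require Import Defs.
From HB Require Import structures.
From mathcomp Require Import all_boot all_order all_algebra.
From mathcomp Require Import all_classical all_reals all_analysis.
From mathcomp Require Import ring lra.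
Set Implicit Arguments.
Unset Strict Implicit.
Unset Printing Implicit Defensive.
Import Order.TTheory GRing.Theory Num.Theory.
Local Open Scope ring_scope.

(** Problem (O) is the minimization of a strictly convex quadratic function of
    the stacked variable [z = (x, u)] over the affine space [E z + b = 0], with
    [E = [A B]].  Two facts carry the proof.

    First, [E] has a right inverse.  Put
    [Theta = - (R + D^T P D)^-1 (B^T P + D^T P C)]; completing the square in
    the Riccati equation turns it into the Lyapunov equation
    [P M + M^T P = - (N^T P N + Q + Theta^T R Theta)] for the closed-loop
    matrices [M = A + B Theta] and [N = C + D Theta].  The right-hand side is
    negative definite, so [M y = 0] forces [y = 0]; hence [M] is invertible
    ([closed_loop_unitmx]), and stacking [M^-1] on top of [Theta M^-1] gives a
    right inverse of [E].

    Secondly, for a positive definite Hessian [H] and a right invertible [E],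
    the Schur complement [E H^-1 E^T] is positive definite, so the multiplier
    system [H z + g + E^T lambda = 0], [E z + b = 0] can be solved by
    elimination ([kkt_exists]).  At a solution of that system the linear part
    of the increment of the objective vanishes along [ker E], and what remains
    is the quadratic form of [H]; so the solution is a strict global minimizer
    ([kkt_strict_min]).  Existence, uniqueness, and both directions of the
    characterization follow: any minimizer must coincide with the one produced
    by the multiplier system, and therefore has a multiplier itself. *)

(** * The Euclidean inner product *)

Lemma addmxE (K : realType) n p (M N : 'M[K]_(n, p)) i j :
  (M + N) i j = M i j + N i j.
Proof. by rewrite mxE. Qed.

Lemma vdotE (K : realType) n (x y : 'cV[K]_n) : vdot x y = (x^T *m y) 0 0.
Proof. by rewrite mxE; apply: eq_bigr => i _; rewrite !mxE. Qed.

Lemma vdotC (K : realType) n (x y : 'cV[K]_n) : vdot x y = vdot y x.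
Proof. by apply: eq_bigr => i _; rewrite mulrC. Qed.

Lemma vdotDl (K : realType) n (x y z : 'cV[K]_n) :
  vdot (x + y) z = vdot x z + vdot y z.
Proof. by rewrite !vdotE linearD mulmxDl mxE. Qed.

Lemma vdotDr (K : realType) n (x y z : 'cV[K]_n) :
  vdot x (y + z) = vdot x y + vdot x z.
Proof. by rewrite !vdotE mulmxDr mxE. Qed.

Lemma vdot0l (K : realType) n (x : 'cV[K]_n) : vdot 0 x = 0.
Proof. by rewrite vdotE trmx0 mul0mx mxE. Qed.

Lemma vdot0r (K : realType) n (x : 'cV[K]_n) : vdot x 0 = 0.
Proof. by rewrite vdotC vdot0l. Qed.

Lemma vdot_mulmx (K : realType) n p (M : 'M[K]_(n, p)) x y :
  vdot (M *m x) y = vdot x (M^T *m y).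
Proof. by rewrite !vdotE trmx_mul mulmxA. Qed.

Lemma vdot_trmx (K : realType) n p (M : 'M[K]_(n, p)) x y :
  vdot (M^T *m x) y = vdot x (M *m y).
Proof. by rewrite vdot_mulmx trmxK. Qed.

Lemma vdot_symmetric (K : realType) n (M : 'M[K]_n) x y :
  symmetric_mx M -> vdot (M *m x) y = vdot (M *m y) x.
Proof. by move=> symM; rewrite vdot_mulmx symM vdotC. Qed.

Lemma vdot_col_mx (K : realType) n m (x y : 'cV[K]_n) (u v : 'cV[K]_m) :
  vdot (col_mx x u) (col_mx y v) = vdot x y + vdot u v.
Proof. by rewrite !vdotE tr_col_mx mul_row_col mxE. Qed.

(** * Positive definite matrices *)

Lemma posdef_ge0 (K : realType) n (M : 'M[K]_n) x :
  posdef_mx M -> 0 <= vdot (M *m x) x.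
Proof.
move=> [_ posM]; have [->|x0] := eqVneq x 0; first by rewrite vdot0r.
exact/ltW/posM.
Qed.

Lemma ker0_unitmx (K : realType) n (M : 'M[K]_n) :
  (forall x : 'cV_n, M *m x = 0 -> x = 0) -> M \in unitmx.
Proof.
move=> kerM; rewrite -unitmx_tr -row_free_unit; apply: inj_row_free => v vM.
apply: trmx_inj; rewrite trmx0; apply: kerM.
by rewrite -[M]trmxK -trmx_mul vM trmx0.
Qed.

Lemma posdef_unitmx (K : realType) n (M : 'M[K]_n) :
  posdef_mx M -> M \in unitmx.
Proof.
move=> [_ posM]; apply: ker0_unitmx => x Mx; apply/eqP/negP => /negP x0.
by have := posM x x0; rewrite Mx vdot0l ltxx.
Qed.

Lemma posdef_invmx (K : realType) n (M : 'M[K]_n) :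
  posdef_mx M -> posdef_mx (invmx M).
Proof.
move=> pdM; have uM := posdef_unitmx pdM; have [symM posM] := pdM.
split=> [|x x0]; first by rewrite /symmetric_mx trmx_inv symM.
have y0 : invmx M *m x != 0.
  by apply: contra_neq x0 => y0; rewrite -[x](mulKVmx uM) y0 mulmx0.
by have := posM _ y0; rewrite mulKVmx // vdotC.
Qed.

Lemma symmetric_congr (K : realType) n p (M : 'M[K]_n) (F : 'M[K]_(n, p)) :
  symmetric_mx M -> symmetric_mx (F^T *m M *m F).
Proof. by move=> symM; rewrite /symmetric_mx !trmx_mul trmxK symM mulmxA. Qed.

Lemma vdot_congr (K : realType) n p (M : 'M[K]_n) (F : 'M[K]_(n, p)) x y :
  vdot (F^T *m M *m F *m x) y = vdot (M *m (F *m x)) (F *m y).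
Proof. by rewrite -!mulmxA vdot_trmx. Qed.

Lemma posdef_congr (K : realType) n p (M : 'M[K]_n) (F : 'M[K]_(n, p)) :
  posdef_mx M -> (forall x : 'cV_p, F *m x = 0 -> x = 0) ->
  posdef_mx (F^T *m M *m F).
Proof.
move=> [symM posM] kerF; split=> [|x x0]; first exact: symmetric_congr.
by rewrite vdot_congr posM //; apply: contra_neq x0 => /kerF.
Qed.

Lemma posdefD_congr (K : realType) n p (L : 'M[K]_p) (M : 'M[K]_n)
    (F : 'M[K]_(n, p)) :
  posdef_mx L -> posdef_mx M -> posdef_mx (L + F^T *m M *m F).
Proof.
move=> [symL posL] pdM; split=> [|x x0].
  rewrite /symmetric_mx linearD /= symL; congr (_ + _).
  exact: symmetric_congr pdM.1.
by rewrite mulmxDl vdotDl vdot_congr ltr_wpDr ?posL // posdef_ge0.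
Qed.

Lemma posdef_block_diag (K : realType) n m (Q : 'M[K]_n) (R : 'M[K]_m) :
  posdef_mx Q -> posdef_mx R -> posdef_mx (block_mx Q 0 0 R).
Proof.
move=> pdQ pdR; split=> [|z].
  by rewrite /symmetric_mx tr_block_mx !trmx0 pdQ.1 pdR.1.
rewrite -[z]vsubmxK mul_block_col !mul0mx addr0 add0r vdot_col_mx => z0.
have [x0|x0] := eqVneq (usubmx z) 0; last first.
  by rewrite ltr_wpDr ?posdef_ge0 // pdQ.2.
rewrite x0 vdot0r add0r pdR.2 //.
by apply: contra_neq z0 => u0; rewrite x0 u0 col_mx0.
Qed.

(** * Strictly convex quadratic programs with linear equality constraints *)

Section QuadraticProgram.
Variables (K : realType) (p N : nat).
Variables (H : 'M[K]_N) (g : 'cV[K]_N) (E : 'M[K]_(p, N)) (b : 'cV[K]_p).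
Hypothesis pdH : posdef_mx H.

Definition quad_obj (z : 'cV[K]_N) : K := vdot (H *m z) z + 2 * vdot g z.

(** The linear part of the increment from [z] to [y] is
    [2 (H z + g) . (y - z) = - 2 lambda . E (y - z)], which vanishes since
    both points satisfy the constraint; the rest is the quadratic form of [H]
    at [y - z]. *)
Lemma kkt_strict_min (z y : 'cV[K]_N) (lambda : 'cV[K]_p) :
  E *m z + b = 0 -> H *m z + g + E^T *m lambda = 0 ->
  E *m y + b = 0 -> y != z -> quad_obj z < quad_obj y.
Proof.
move=> Ez kkt Ey neq; pose w := y - z.
have Ew : E *m w = 0.
  by rewrite mulmxBr; apply/eqP; rewrite subr_eq0 -(inj_eq (addIr b)) Ey Ez.
have lin : vdot (H *m z) w + vdot g w = 0.
  have -> : vdot (H *m z) w + vdot g w = - vdot (E^T *m lambda) w.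
    by apply/eqP; rewrite -addr_eq0 -!vdotDl kkt vdot0l.
  by rewrite vdot_trmx Ew vdot0r oppr0.
have posw : 0 < vdot (H *m w) w by apply: pdH.2; rewrite subr_eq0.
have -> : y = z + w by rewrite /w addrC subrK.
(* Keep the direction [w] atomic, so that bilinearity does not expand it. *)
clearbody w.
rewrite /quad_obj mulmxDr !vdotDl !vdotDr (vdot_symmetric w z pdH.1).
lra.
Qed.

(** Eliminating [z = - H^-1 (g + E^T lambda)] leaves a linear system for
    [lambda] whose matrix [E H^-1 E^T] is positive definite because [E^T] is
    injective. *)
Lemma kkt_exists (E' : 'M[K]_(N, p)) :
  E *m E' = 1%:M ->
  exists z lambda, E *m z + b = 0 /\ H *m z + g + E^T *m lambda = 0.
Proof.
move=> EE'; have uH := posdef_unitmx pdH.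
have uS : E *m invmx H *m E^T \in unitmx.
  rewrite -[X in X *m _ *m _]trmxK; apply: posdef_unitmx.
  apply: posdef_congr => [|x Ex]; first exact: posdef_invmx.
  by rewrite -[x]mul1mx -trmx1 -EE' trmx_mul -mulmxA Ex mulmx0.
pose S := E *m invmx H *m E^T.
pose lambda := invmx S *m (b - E *m invmx H *m g).
exists (- (invmx H *m (g + E^T *m lambda))), lambda; split.
  rewrite mulmxN mulmxA mulmxDr [_ *m (E^T *m _)]mulmxA -/S /lambda mulKVmx //.
  by rewrite addrC [X in b - X]addrC subrK subrr.
by rewrite mulmxN mulKVmx // -addrA addNr.
Qed.

End QuadraticProgram.

(** * The closed-loop matrix of the Riccati equation *)

Section ClosedLoop.
Variables (K : realType) (n m : nat) (A C : 'M[K]_n) (B D : 'M[K]_(n, m)).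
Variables (Q : 'M[K]_n) (R : 'M[K]_m) (P : 'M[K]_n).
Hypotheses (pdQ : posdef_mx Q) (pdR : posdef_mx R) (pdP : posdef_mx P).
Hypothesis are : riccati_equation A C B D Q R P.

Definition riccati_gain : 'M[K]_(m, n) :=
  - (invmx (R + D^T *m P *m D) *m (B^T *m P + D^T *m P *m C)).

(** Completing the square: with [S = R + D^T P D], [L = B^T P + D^T P C] and
    [S Theta = - L], the [Theta]-dependent terms
    [L^T Theta + Theta^T L + Theta^T S Theta] collapse to
    [L^T Theta = - L^T S^-1 L]. *)
Lemma riccati_lyapunov :
  let M := A + B *m riccati_gain in let N := C + D *m riccati_gain in
  P *m M + M^T *m P + N^T *m P *m N + Q
    + riccati_gain^T *m R *m riccati_gain = 0.
Proof.
move=> M N.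
pose S := R + D^T *m P *m D; pose L := B^T *m P + D^T *m P *m C.
have uS : S \in unitmx by apply: posdef_unitmx; apply: posdefD_congr.
pose G := riccati_gain.
have SG : R *m G + D^T *m P *m D *m G = - L.
  by rewrite -mulmxDl mulmxN mulKVmx.
have are' : P *m A + A^T *m P + C^T *m P *m C + Q
    + (P *m B + C^T *m P *m D) *m G = 0.
  by rewrite mulmxN mulmxA; apply: are.
rewrite /M /N -/G; clearbody G => {M N}.
have GSG : G^T *m R *m G + G^T *m D^T *m P *m D *m G
    + G^T *m B^T *m P + G^T *m D^T *m P *m C = 0.
  have /eqP := congr1 (mulmx G^T) SG.
  by rewrite mulmxN -addr_eq0 !mulmxDr !mulmxA addrA => /eqP.
rewrite -[RHS]are' -[RHS]addr0 -GSG !linearD /= !trmx_mul.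
rewrite !(mulmxDl, mulmxDr) !mulmxA.
by apply/matrixP => i j; rewrite !addmxE; ring.
Qed.

(** If [M x = 0], evaluating the Lyapunov equation at [x] leaves a sum of
    nonnegative terms, one of which is [Q x . x]. *)
Lemma closed_loop_unitmx : A + B *m riccati_gain \in unitmx.
Proof.
apply: ker0_unitmx => x Mx; apply/eqP/negP => /negP x0.
have := congr1 (fun Z => vdot (Z *m x) x) riccati_lyapunov.
rewrite /= mul0mx vdot0l !(mulmxDl _ _ x) !(vdotDl _ _ x) !vdot_congr.
set N := C + _; set M := A + _ in Mx *.
rewrite -!mulmxA vdot_trmx Mx mulmx0 vdot0l vdot0r !add0r => sum0.
have {x0} Qx := pdQ.2 _ x0; have PNx := posdef_ge0 (N *m x) pdP.
have RGx := posdef_ge0 (riccati_gain *m x) pdR.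
suff : 0 < 0 :> K by rewrite ltxx.
lra.
Qed.

End ClosedLoop.

(** * Problem (O) *)

Section ProblemO.
Variables (K : realType) (n m : nat) (A C : 'M[K]_n) (B D : 'M[K]_(n, m)).
Variables (Q : 'M[K]_n) (R : 'M[K]_m) (b sigma q : 'cV[K]_n) (P : 'M[K]_n).

(** Half the Hessian of the objective in the stacked variable. *)
Definition hessian : 'M[K]_(n + m) :=
  block_mx Q 0 0 R + (row_mx C D)^T *m P *m row_mx C D.

(** Half the gradient of the objective at the origin. *)
Definition gradient0 : 'cV[K]_(n + m) :=
  col_mx q 0 + (row_mx C D)^T *m (P *m sigma).

Lemma objective_quad x u : symmetric_mx P ->
  objective C D Q R sigma q P x u
  = quad_obj hessian gradient0 (col_mx x u) + vdot (P *m sigma) sigma.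
Proof.
move=> symP; rewrite /objective /quad_obj !mulmxDl !vdotDl vdot_congr vdot_trmx.
rewrite mul_block_col !mul0mx addr0 add0r !vdot_col_mx vdot0l mul_row_col.
set z := C *m x + D *m u; clearbody z.
rewrite mulmxDr !vdotDl !vdotDr (vdot_symmetric z sigma symP).
ring.
Qed.

Lemma feasible_row x u :
  feasible A B b x u <-> row_mx A B *m col_mx x u + b = 0.
Proof. by rewrite mul_row_col. Qed.

Lemma kkt_col x u lambda :
  hessian *m col_mx x u + gradient0 + (row_mx A B)^T *m lambda = 0 <->
  Q *m x + A^T *m lambda + C^T *m P *m (C *m x + D *m u + sigma) + q = 0 /\
  R *m u + B^T *m lambda + D^T *m P *m (C *m x + D *m u + sigma) = 0.
Proof.
have -> : hessian *m col_mx x u + gradient0 + (row_mx A B)^T *m lambda =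
  col_mx
    (Q *m x + A^T *m lambda + C^T *m P *m (C *m x + D *m u + sigma) + q)
    (R *m u + B^T *m lambda + D^T *m P *m (C *m x + D *m u + sigma)).
  rewrite /hessian /gradient0 mulmxDl mul_block_col !mul0mx addr0 add0r.
  rewrite -!mulmxA mul_row_col !tr_row_mx !mul_col_mx !add_col_mx add0r.
  by congr col_mx; rewrite !mulmxDr; apply/matrixP => i j; rewrite !addmxE; ring.
split=> [/eqP|[-> ->]]; last exact: col_mx0.
by rewrite col_mx_eq0 => /andP[/eqP -> /eqP ->].
Qed.

End ProblemO.

Theorem proposition3p6 (K : realType) (d : measure_display)
    (T : measurableType d) (Pr : probability T K) (W : K -> {RV Pr >-> K})
    (hW : brownian_motion W)
    (n m : nat) (A C : 'M[K]_n) (B D : 'M[K]_(n, m))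
    (Q : 'M[K]_n) (R : 'M[K]_m) (b sigma q : 'cV[K]_n)
    (hstab : L2_stabilizable W A C B D)
    (hQ : posdef_mx Q) (hR : posdef_mx R)
    (P : 'M[K]_n) (hP : posdef_mx P)
    (hARE : riccati_equation A C B D Q R P) :
  (exists! xu : 'cV[K]_n * 'cV[K]_m,
     solves_problem_O A C B D Q R b sigma q P xu.1 xu.2) /\
  (forall (xs : 'cV[K]_n) (us : 'cV[K]_m), feasible A B b xs us ->
     (solves_problem_O A C B D Q R b sigma q P xs us <->
      exists lambda : 'cV[K]_n,
        Q *m xs + A^T *m lambda
          + C^T *m P *m (C *m xs + D *m us + sigma) + q = 0 /\
        R *m us + B^T *m lambda
          + D^T *m P *m (C *m xs + D *m us + sigma) = 0)).
Proof.
set E := row_mx A B.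
set H := hessian C D Q R P; set g := gradient0 C D sigma q P.
have pdH : posdef_mx H by apply: posdefD_congr => //; apply: posdef_block_diag.
set M := A + B *m riccati_gain C B D R P.
have uM : M \in unitmx by apply: closed_loop_unitmx hARE.
have EE' : E *m col_mx (invmx M) (riccati_gain C B D R P *m invmx M) = 1%:M.
  by rewrite mul_row_col mulmxA -mulmxDl mulmxV.
have min_kkt x u lambda : feasible A B b x u ->
    H *m col_mx x u + g + E^T *m lambda = 0 ->
    forall y v, feasible A B b y v -> (y, v) <> (x, u) ->
    objective C D Q R sigma q P x u < objective C D Q R sigma q P y v.
  move=> /feasible_row Exu kkt y v /feasible_row Eyv neq.
  rewrite !(objective_quad _ _ _ _ _ _ _ _ hP.1) ltrD2r.
  apply: (kkt_strict_min pdH Exu kkt Eyv).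
  by apply/eqP => /eq_col_mx[yx vu]; apply: neq; rewrite yx vu.
have [z [l0 []]] := kkt_exists g b pdH EE'.
rewrite -[z]vsubmxK; set x0 := usubmx z; set u0 := dsubmx z.
move=> /feasible_row feas0 kkt0.
have solves_kkt x u lambda : feasible A B b x u ->
    H *m col_mx x u + g + E^T *m lambda = 0 ->
    solves_problem_O A C B D Q R b sigma q P x u.
  move=> feas kkt; split=> // y v feas_yv.
  have [[-> ->]//|/eqP neq] := eqVneq (y, v) (x, u).
  exact/ltW/(min_kkt _ _ _ feas kkt).
have uniq0 x u : solves_problem_O A C B D Q R b sigma q P x u ->
    (x, u) = (x0, u0).
  move=> [feas min]; apply/eqP/negP => /negP/eqP neq.
  by have := min_kkt _ _ _ feas0 kkt0 _ _ feas neq; rewrite ltNge min.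
split.
  exists (x0, u0); split; first exact: solves_kkt feas0 kkt0.
  by move=> [x u] /uniq0.
move=> xs us feas; split=> [/uniq0[-> ->]|[lambda /kkt_col kkt]].
  by exists l0; apply/kkt_col.
exact: solves_kkt feas kkt.
Qed.
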